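(* Let $X$ be a metrizable space. Assume that $X$ is non-compact, weight-homogeneous, and has a $\pi$-base consisting of clopen sets. Then $X$ can be partitioned into $\mathsf{w}(X)$ many clopen sets.
   Context: The weight $\mathsf{w}(X)$ of a topological space $X$ is the maximum between $\omega$ and the minimal cardinality of a base for $X$. A space $X$ is weight-homogeneous if $\mathsf{w}(U)=\mathsf{w}(X)$ for every non-empty open subspace $U$ of $X$. A $\pi$-base for $X$ is a collection $\mathcal{B}$ of non-empty open subsets of $X$ such that for every non-empty open subset $U$ of $X$ there exists $V\in\mathcal{B}$ with $V\subseteq U$. A space $X$ can be partitioned into $\kappa$ many clopen sets if there is a family of exactly $\kappa$ many pairwise disjoint non-empty clopen subsets of $X$ whose union is $X$. *)

(* Defs.v *)
From mathcomp Require Import all_boot all_order all_algebra.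
From mathcomp Require Import all_classical all_reals.
From mathcomp Require Import topology.
Set Implicit Arguments.
Unset Strict Implicit.
Unset Printing Implicit Defensive.
Import Order.TTheory GRing.Theory Num.Theory.
Local Open Scope classical_set_scope.
Local Open Scope card_scope.
Local Open Scope ring_scope.

(* Nonnegativity of [d] follows from the conditions listed. *)
Definition metrizable (R : realType) (X : topologicalType) :=
  exists d : X -> X -> R,
    [/\ forall x y, d x y = 0 <-> x = y,
        forall x y, d x y = d y x,
        forall x y z, d x z <= d x y + d y z &
        forall U : set X, open U <->
          forall x, U x -> exists2 e : R, 0 < e & [set y | d x y < e] `<=` U].

(* A cardinal is represented by a set, up to [#=]; the sum type only serves to
   give both cases of the maximum a common type. *)
Definition card_max (T U : Type) (A : set T) (B : set U) : set (T + U) :=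
  if A #<= B then inr @` B else inl @` A.

Definition least_card (T : Type) (F : set (set T)) : set (set T) :=
  [set A | F A /\ forall B, F B -> A #<= B].

Lemma least_card_nonempty (T : Type) (F : set (set T)) :
  F !=set0 -> least_card F !=set0.
Proof.
move=> [A0 FA0].
pose P (S : set (set T -> T)) :=
  (forall f, S f -> forall A, F A -> A (f A)) /\
  (forall f g, S f -> S g -> forall A, F A -> f A = g A -> f = g).
have [S [[S1 S2] Smax]] : exists S, P S /\ forall S', S `<` S' -> ~ P S'.
  apply: Zorn_bigcup => G GP Gtot; split.
    by move=> f [S GS Sf] A FA; by have [H _] := GP _ GS; exact: (H f Sf A FA).
  move=> f g [S GS Sf] [S' GS' S'g] A FA.
  have [SS'|S'S] := Gtot _ _ GS GS'.
    by have [_ H] := GP _ GS'; apply: H => //; exact: SS'.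
  by have [_ H] := GP _ GS; apply: H => //; exact: S'S.
have [A [FA SA]] : exists A, F A /\ forall a, A a -> exists2 f, S f & f A = a.
  apply: contrapT => nA.
  have step A : F A -> exists2 a, A a & forall f, S f -> f A <> a.
    move=> FA; apply: contrapT => nS; apply: nA; exists A; split => // a Aa.
    apply: contrapT => nf; apply: nS; exists a => // f Sf fA.
    by apply: nf; exists f.
  have [x0 _ _] := step _ FA0.
  have /choice[g gP] A : exists a, F A -> A a /\ forall f, S f -> f A <> a.
    have [/step[a Aa aS]|nFA] := pselect (F A); first by exists a.
    by exists x0.
  apply: (Smax (S `|` [set g])).
    split; first by move=> f Sf; left.
    move=> /(_ g (or_intror erefl)) Sg.
    by have [_ H] := gP _ FA0; exact: H Sg erefl.
  split.
    move=> f [Sf|->] A FA; [exact: (S1 f Sf A FA)|by have [] := gP _ FA].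
  move=> f h [Sf|->] [Sh|->] A FA //.
  - exact: S2.
  - by have [_ H] := gP _ FA; move/(H _ Sf).
  - by have [_ H] := gP _ FA; move/esym/(H _ Sh).
exists A; split => // B FB.
have /choice[p pP] a : exists f : set T -> T, A a -> S f /\ f A = a.
  have [/SA[f Sf fa]|nAa] := pselect (A a); first by exists f.
  by exists (fun=> a).
suff /injfunPex[f] : exists2 f : T -> T, set_fun A B f & set_inj A f.
  exact: inj_card_le.
exists (fun a => p a B) => [a Aa|a b /set_mem Aa /set_mem Ab pab].
  by have [Sa _] := pP _ Aa; exact: (S1 (p a) Sa B FB).
have [Sa <-] := pP _ Aa; have [Sb] := pP _ Ab.
by rewrite (S2 _ _ Sa Sb _ FB pab).
Qed.

Section weight.
Variable X : topologicalType.

Definition min_basis : set (set X) := xget set0 (least_card (@basis X)).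

Lemma min_basisP : least_card (@basis X) min_basis.
Proof.
apply: xgetPex; apply: least_card_nonempty; exists open; split => // x U.
by rewrite nbhsE => -[V [oV Vx] VU]; exists V.
Qed.

Definition weight := card_max [set: nat] min_basis.

End weight.
Arguments min_basis X : clear implicits.
Arguments min_basisP X : clear implicits.
Arguments weight X : clear implicits.

(* In [weight U], the set [U] is coerced to its subtype, which carries the
   subspace topology. *)
Definition weight_homogeneous (X : topologicalType) :=
  forall U : set X, open U -> U !=set0 -> weight U #= weight X.

Definition pi_base (X : topologicalType) (B : set (set X)) :=
  (forall V, B V -> open V /\ V !=set0) /\
  (forall U, open U -> U !=set0 -> exists2 V, B V & V `<=` U).

Definition clopen_partition (X : topologicalType) (P : set (set X)) :=
  partition P id [set: X] /\ P `<=` clopen.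

(* Main.v *)
(* Clopen partitions are the families of fibres of locally constant functions,
   so it is enough to find such a function whose range is infinite and at least
   as large as a least base. Clopen members of the pi-base inside a locally
   finite family of open sets provide locally constant functions.
   If X has a countable base, a filter without cluster points gives an infinite
   locally finite sequence of open sets.
   Otherwise choose in every open U a maximal 1/(k+1)-separated subset N(U, k);
   balls around its points show that U has a clopen partition of size N(U, k),
   and the disjoint union of the N(U, k) over k has size at least w(U) = w(X).
   In particular every nonempty open set has an infinite clopen partition. Let
   V_0, V_1, ... be a clopen partition of X. If every V_n contains some N(V_n, k)
   at least as large as N(X, n), split each V_n into N(X, n) pieces. If some V_n
   does not, all N(V_n, k) inject into N(X, n), so it is enough to split X into
   N(X, n) pieces and each piece further into countably many; this avoids
   any arithmetic of uncountable cardinals, such as cofinality or aleph_0 * k = k. *)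
Require Import Defs.
From mathcomp Require Import all_boot all_order all_algebra finmap.
From mathcomp Require Import all_classical all_reals.
From mathcomp Require Import topology lra.
Set Implicit Arguments.
Unset Strict Implicit.
Unset Printing Implicit Defensive.
Import Order.TTheory GRing.Theory Num.Theory.
Local Open Scope classical_set_scope.
Local Open Scope card_scope.
Local Open Scope ring_scope.

(** * Comparing cardinals through relations *)

Lemma card_le_fun (T U : Type) (A : set T) (B : set U) (f : T -> U) :
  set_fun A B f -> set_inj A f -> A #<= B.
Proof.
by move=> Af injf; have /injfunPex[g] := ex_intro2 _ _ f Af injf; exact: inj_card_le.
Qed.

(** A multivalued injection suffices: choice picks one related [b] for each [a], and the injectivity
    of [r] carries over. Witnesses can then be described by a property instead of being named. *)
Lemma card_le_relP (T U : Type) (A : set T) (B : set U) :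
  A #<= B <-> exists r : T -> U -> Prop,
    (forall a, A a -> exists2 b, B b & r a b) /\
    (forall a a' b, A a -> A a' -> r a b -> r a' b -> a = a').
Proof.
split.
  move=> /card_leP[f].
  exists (fun a b => exists2 p : A, val p = a & val (f p) = b); split.
    move=> a /mem_set Aa; exists (val (f (SigSub Aa))); first exact: set_valP.
    by exists (SigSub Aa).
  move=> a a' b _ _ [p <- <-] [q <- /val_inj fqp].
  by congr val; apply: (@inj _ _ _ f); rewrite ?inE.
move=> [r [rB rinj]].
have [->|/set0P[a0 /rB[b0 _ _]]] := eqVneq A set0; first exact: card_ge0.
have /choice[f fP] a : exists b, A a -> B b /\ r a b.
  have [/rB[b Bb rab]|nAa] := pselect (A a); first by exists b.
  by exists b0.
apply: (@card_le_fun _ _ _ _ f) => [a /fP[]//|a a' /set_mem Aa /set_mem Aa' faa'].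
by apply: (rinj a a' (f a)) => //; [have [] := fP _ Aa|rewrite faa'; have [] := fP _ Aa'].
Qed.

Lemma card_le_image_rel (T U : Type) (A : set T) (f : T -> U) : f @` A #<= A.
Proof.
apply/card_le_relP; exists (fun b a => f a = b); split.
  by move=> _ [a Aa <-]; exists a.
by move=> b b' a _ _ <-.
Qed.

(** The index is carried along to keep the images apart; it goes second to match the set of pairs
    counted in [locally_constant_refine]. *)
Lemma card_le_sigma (I T U : Type) (A : I -> set T) (B : set U) :
  (forall i, A i #<= B) ->
  [set p : I * T | A p.1 p.2] #<= [set p : U * I | B p.1].
Proof.
move=> AB; have /choice[r rP] i := (card_le_relP _ _).1 (AB i).
apply/card_le_relP; exists (fun p q => p.1 = q.2 /\ r p.1 p.2 q.1); split.
  move=> [i a] /= Aia; have [/(_ _ Aia)[b Bb rab] _] := rP i.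
  by exists (b, i).
move=> [i a] [j a'] [b k] /= Aia Aja' [ik rab] [jk ra'b]; subst i j.
by have [_ /(_ a a' b)->] := rP k.
Qed.

Lemma card_le_total (T : Type) (A B : set T) : A #<= B \/ B #<= A.
Proof.
(* Comparability is the existence of a least cardinal in a family of two sets. *)
have [] := @least_card_nonempty _ [set A; B].
  by exists A; left.
move=> C [[]-> leC]; [left|right]; apply: leC; [by right|by left].
Qed.

Lemma card_max_le (T U V : Type) (A : set T) (B : set U) (C : set V) :
  A #<= C -> B #<= C -> card_max A B #<= C.
Proof.
move=> AC BC; rewrite /card_max.
by case: ifP => _; (apply: card_le_trans (card_le_image_rel _ _) _).
Qed.

Lemma min_basis_card_le_weight (X : topologicalType) : min_basis X #<= weight X.
Proof.
rewrite /weight /card_max; case: ifPn => [_|/negP nX].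
  by apply: (@card_le_fun _ _ _ _ inr) => [b Xb|b b' _ _ []//]; exists b.
apply: (@card_le_trans _ _ _ [set: nat]).
  by apply: finite_set_countable; exact: contrapT (contra_not (infiniteP _).1 nX).
by apply: (@card_le_fun _ _ _ _ inl) => [n _|n m _ _ []//]; exists n.
Qed.

(** * Locally constant functions and clopen partitions *)

Definition locally_constant (X : topologicalType) (T : Type) (f : X -> T) :=
  forall x, \forall y \near x, f y = f x.

Section locally_constant.
Variable X : topologicalType.

Lemma locally_constant_open (T : Type) (f : X -> T) (B : set T) :
  locally_constant f -> open (f @^-1` B).
Proof.
move=> lcf; rewrite openE => x /= Bfx; rewrite /interior.
by apply: filterS (lcf x) => y /= ->.
Qed.

Lemma locally_constant_clopen (T : Type) (f : X -> T) (B : set T) :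
  locally_constant f -> clopen (f @^-1` B).
Proof.
move=> lcf; split; first exact: locally_constant_open.
by rewrite -openC; exact: (@locally_constant_open _ f (~` B)).
Qed.

Lemma locally_constant_comp (T U : Type) (f : X -> T) (u : T -> U) :
  locally_constant f -> locally_constant (u \o f).
Proof. by move=> lcf x; apply: filterS (lcf x) => y /= ->. Qed.

Lemma fibers_clopen_partition (T : Type) (f : X -> T) :
  locally_constant f ->
  exists2 P : set (set X), clopen_partition P & range f #<= P.
Proof.
move=> lcf; exists ((fun t => f @^-1` [set t]) @` range f); first split; first split.
- apply/seteqP; split => // x _; exists (f @^-1` [set f x]) => //.
  by exists (f x) => //; exists x.
- by move=> _ _ [s _ <-] [t _ <-] [x [/= <- <-]].
- by move=> _ [_ [x _ <-] <-]; exists x.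
- by move=> _ [t _ <-]; exact: locally_constant_clopen.
apply: (@card_le_fun _ _ _ _ (fun t => f @^-1` [set t])).
  by move=> t rt; exists t.
by move=> _ t /set_mem[x _ <-] _ /seteqP[/(_ x erefl)].
Qed.

(** Each piece contains a nonempty basic set, which by disjointness lies in no other piece. *)
Lemma clopen_partition_card_le (P : set (set X)) :
  clopen_partition P -> P #<= min_basis X.
Proof.
move=> [[_ trivP P0] Pclo]; have [[Bo Bb] _] := min_basisP X.
apply/card_le_relP; exists (fun V B => B `<=` V /\ B !=set0); split.
  move=> V PV; have [x Vx] := P0 _ PV; have [oV _] := Pclo _ PV.
  have [B [bB Bx] BV] := Bb x V (open_nbhs_nbhs (conj oV Vx)).
  by exists B => //; split => //; exists x.
move=> V W B PV PW [BV [x Bx]] [BW _]; apply: trivP => //.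
by exists x; split; [exact: BV|exact: BW].
Qed.

(** The functions [h t] are glued along the fibres of [f]; recording the value of [f] keeps pieces
    of different fibres apart. *)
Lemma locally_constant_refine (T U V : Type) (f : X -> T) (h : T -> X -> U)
    (A : T -> set V) :
  locally_constant f -> (forall t, locally_constant (h t)) ->
  (forall t, range f t -> A t #<= h t @` (f @^-1` [set t])) ->
  exists2 g : X -> T * U, locally_constant g &
    [set p | range f p.1 /\ A p.1 p.2] #<= range g.
Proof.
move=> lcf lch Ah; exists (fun x => (f x, h (f x) x)).
  move=> x; apply: filterS2 (lcf x) (lch (f x) x) => y -> -> //.
have /choice[r rP] t : exists r : V -> U -> Prop, range f t ->
    (forall a, A t a -> exists2 b, (h t @` (f @^-1` [set t])) b & r a b) /\
    (forall a a' b, A t a -> A t a' -> r a b -> r a' b -> a = a').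
  have [/Ah/card_le_relP[r rP]|nt] := pselect (range f t); first by exists r.
  by exists (fun _ _ => True).
apply/card_le_relP; exists (fun p q => p.1 = q.1 /\ r q.1 p.2 q.2); split.
  move=> [t v] /= [ft Atv]; have [/(_ _ Atv)[_ [x <- <-] rvx] _] := rP _ ft.
  by exists (f x, h (f x) x) => //; exists x.
move=> [t v] [t' v'] [s u] /= [ft Atv] [_ Atv'] [ts ru] [ts' ru'].
subst t t'.
by have [_ /(_ v v' u)->] := rP _ ft.
Qed.

Lemma locally_finite_locally_constant (I : choiceType) (C : I -> set X) :
  (forall i, clopen (C i)) ->
  (forall x : X, exists2 D : set I, finite_set D & (
    \forall y \near x, forall i, C i y -> D i)) ->
  locally_constant (fun x => [set i | C i x]).
Proof.
move=> Cclo Cfin x; have [D /finite_fsetP[E ->] xD] := Cfin x.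
(* Near [x] only the finitely many indices in [E] matter, and for each of them either [C i] or its
   complement is a neighbourhood of [x]. *)
have xE : nbhs x (\bigcap_(i in [set` E]) [set y | C i y <-> C i x]).
  apply: filter_bigI => i _; have [oC cC] := Cclo i.
  have [Cx|nCx] := pselect (C i x).
    by apply: filterS (open_nbhs_nbhs (conj oC Cx : open_nbhs x (C i))).
  by apply: filterS (open_nbhs_nbhs (conj (closed_openC cC) nCx : open_nbhs x _)).
have := nbhs_singleton xD => /= xC; apply: filterS2 xD xE => y yD yE; apply/seteqP; split=> i /= Ci.
  by apply/yE => //; exact: yD.
by apply/yE => //; exact: xC.
Qed.

Lemma infinite_range_surj (T : Type) (f : X -> T) :
  locally_constant f -> infinite_set (range f) ->
  exists2 g : X -> nat, locally_constant g & range g = setT.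
Proof.
move=> lcf /infiniteP/card_le_relP[r [rf rinj]].
(* Values related to no [n] go to 0, which does not harm surjectivity. *)
exists ((fun t => xget 0%N [set n | r n t]) \o f).
  exact: locally_constant_comp.
apply/seteqP; split => // n _; have [_ [x _ <-] rnx] := rf n I.
exists x => //=; case: xgetP => [m _ /= rmx|/(_ n)//].
exact: (rinj _ _ (f x)).
Qed.

End locally_constant.

(** * Separated sets and nets in a metric space *)

Section metric.
Variables (R : realType) (X : topologicalType) (d : X -> X -> R).
Hypothesis d0 : forall x y, d x y = 0 <-> x = y.
Hypothesis dC : forall x y, d x y = d y x.
Hypothesis dD : forall x y z, d x z <= d x y + d y z.
Hypothesis open_dP : forall U : set X, open U <->
  forall x, U x -> exists2 e : R, 0 < e & [set y | d x y < e] `<=` U.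

Local Notation ball_d x e := [set y | d x y < e].

Let dxx x : d x x = 0. Proof. exact/d0. Qed.

Let open_ball_d x e : open (ball_d x e).
Proof.
apply/open_dP => y /= xy; exists (e - d x y); first by rewrite subr_gt0.
by move=> z /= yz; have := dD x y z; rewrite /= => *; lra.
Qed.

Let nbhs_ball_d x e : 0 < e -> nbhs x (ball_d x e).
Proof. by move=> e0; apply: open_nbhs_nbhs; split => //=; rewrite dxx. Qed.

Let nbhs_dP x (A : set X) : nbhs x A -> exists2 e : R, 0 < e & ball_d x e `<=` A.
Proof.
rewrite nbhsE => -[V [/open_dP oV Vx] VA]; have [e e0 eV] := oV _ Vx.
by exists e => //; exact: subset_trans VA.
Qed.

Definition separated_by (e : R) (S : set X) :=
  forall s t, S s -> S t -> d s t < e -> s = t.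

Lemma maximal_separated (U : set X) (e : R) : 0 < e ->
  exists S, [/\ S `<=` U, separated_by e S &
    forall x, U x -> exists2 s, S s & d s x < e].
Proof.
move=> e0.
have [S [[SU Ssep] Smax]] : exists S, (S `<=` U /\ separated_by e S) /\
    forall S', S `<` S' -> ~ (S' `<=` U /\ separated_by e S').
  apply: Zorn_bigcup => F FP Ftot; split.
    by move=> x [S /FP[SU _]]; exact: SU.
  move=> s t [S FS Ss] [S' FS' S't].
  have [SS'|S'S] := Ftot _ _ FS FS'.
    by have [_] := FP _ FS'; apply => //; exact: SS'.
  by have [_] := FP _ FS; apply => //; exact: S'S.
(* A point of [U] at distance at least [e] from all of [S] could be added to [S]. *)
exists S; split => // x Ux; apply: contrapT => nx.
have far s : S s -> ~ d s x < e by move=> Ss sx; apply: nx; exists s.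
apply: (Smax (S `|` [set x])).
  split; first by move=> s; left.
  by move=> /(_ x (or_intror erefl))/far; rewrite dxx.
split; first by move=> s [/SU//|->].
move=> s t [Ss|->] [St|->] //; first exact: Ssep.
  by move/(far _ Ss).
by rewrite dC => /(far _ St).
Qed.

(** The traces on [U] of the balls of radius 1/(k+1) about the points of [N k] form a base of
    [U]. *)
Lemma min_basis_card_le_nets (U : set X) (N : nat -> set X) :
  (forall k x, U x -> exists2 s, N k s & d s x < k.+1%:R^-1) ->
  min_basis U #<= [set p | N p.1 p.2].
Proof.
move=> NU.
pose f (p : nat * X) : set U := set_val @^-1` ball_d p.2 p.1.+1%:R^-1.
apply: card_le_trans (card_le_image_rel _ f).
apply: (min_basisP U).2; split.
  by move=> _ [p _ <-]; exists (ball_d p.2 p.1.+1%:R^-1).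
move=> x A; rewrite nbhsE => -[W [[V oV <-] Vx] VA].
have [e e0 eV] := (open_dP V).1 oV _ Vx.
have [|k] := @ltr_add_invr R 0 (e / 2); first lra.
rewrite add0r => ke.
have [s Nks sx] := NU k (set_val x) (set_valP x).
exists (f (k, s)); first by split => //; exists (k, s).
move=> y /= sy; apply: VA; apply: eV => /=.
have {}sx := lt_trans sx ke; have {}sy := lt_trans (sy : d s (set_val y) < _) ke.
by have := dD (set_val x) s (set_val y); rewrite (dC (set_val x) s); lra.
Qed.

(** * Locally constant functions from a clopen pi-base *)

Variable B : set (set X).
Hypothesis piB : pi_base B.
Hypothesis Bclopen : B `<=` clopen.

Let clopen_below (U : set X) : open U -> U !=set0 ->
  exists C, [/\ clopen C, C !=set0 & C `<=` U].
Proof.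
move=> oU U0; have [C BC CU] := piB.2 _ oU U0.
by exists C; split => //; [exact: Bclopen|have [] := piB.1 _ BC].
Qed.

(** Clopen sets are chosen within e/4 of the points of [S]. A ball of radius e/4 meets at most one
    of them, since four steps shorter than e/4 would join two points of [S]. *)
Lemma separated_locally_constant (U S : set X) (e : R) :
  open U -> S `<=` U -> 0 < e -> separated_by e S ->
  exists2 f : X -> set X, locally_constant f & S #<= f @` U.
Proof.
move=> oU SU e0 Ssep.
have /choice[C CP] s : exists C, clopen C /\ (S s -> C !=set0) /\
    (forall x, C x -> [/\ S s, U x & d s x < e / 4]).
  have [Ss|nSs] := pselect (S s); last first.
    by exists set0; split; [exact: clopen0|split].
  have [||C [cC C0 CU]] := @clopen_below (U `&` ball_d s (e / 4)).
  - exact: openI.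
  - by exists s; split; [exact: SU|rewrite /= dxx; lra].
  by exists C; split => //; split => // x /CU[].
exists (fun x => [set s | C s x]).
  apply: locally_finite_locally_constant => [s|x]; first by have [] := CP s.
  exists [set s | exists2 y, C s y & d x y < e / 4].
    have [->|/set0P[s0 [y0 Cy0 xy0]]] :=
        eqVneq [set s | exists2 y, C s y & d x y < e / 4] set0 => //.
    apply: (@sub_finite_set _ _ [set s0]) => // s [y Cy xy] /=.
    have [_ [_ /(_ _ Cy)[Ss _ sy]]] := CP s.
    have [_ [_ /(_ _ Cy0)[Ss0 _ sy0]]] := CP s0.
    apply: Ssep => //.
    have := dD s y s0; have := dD y x s0; have := dD x y0 s0.
    by rewrite (dC y x) (dC y0 s0) => *; lra.
  apply: filterS (nbhs_ball_d x (_ : 0 < e / 4)) => //; last by lra.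
  by move=> y xy s Csy; exists y.
(* At a point of [C s] the function takes the value [[set s]]. *)
apply/card_le_relP; exists (fun s (A : set X) => A s /\ A `<=` [set s]); split.
  move=> s Ss; have [_ [/(_ Ss)[x Csx] CU]] := CP s.
  have [_ Ux sx] := CU _ Csx.
  exists [set t | C t x]; first by exists x.
  split => // t /= Ctx; have [_ [_ /(_ _ Ctx)[St _ tx]]] := CP t.
  by apply: Ssep => //; have := dD t x s; rewrite (dC x s) => *; lra.
by move=> s t A _ _ [As _] [_ /(_ s As)].
Qed.

(* The clopen sets [C n] avoid longer and longer initial segments of a
   countable open cover, hence are locally finite. *)
Lemma noncompact_locally_constant :
  ~ compact [set: X] -> countable (min_basis X) ->
  exists2 f : X -> set nat, locally_constant f & infinite_set (range f).
Proof.
move=> ncpt /card_le_relP[r [rB rinj]].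
have [F [FF Fcl]] : exists F : set_system X, ProperFilter F /\ cluster F = set0.
  apply: contrapT => nF; apply: ncpt => F FF _.
  rewrite setTI; apply/set0P/negP => /eqP F0; apply: nF; by exists F.
have [[Bo Bb] _] := min_basisP X.
(* Asking for the interior of the complement makes the sets [O n] below open. Such [b] still cover:
   if [A] in [F] misses the e-ball at [x], a basic set in the e/2-ball stays clear of the e/2-balls
   about points of [A]. *)
pose D := [set b | min_basis X b /\ F (~` b)^°].
have Dcov x : exists2 b, D b & b x.
  have : ~ cluster F x by rewrite Fcl.
  move=> nx; apply: contrapT => nb; apply: nx => A N FA /nbhs_dP[e e0 eN].
  apply: contrapT => AN; apply: nb.
  have e20 : 0 < e / 2 by lra.
  have [b [bB bx] be] := Bb x _ (nbhs_ball_d x e20).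
  exists b => //; split => //; apply: filterS FA => y Ay.
  apply: (@filterS _ _ _ (ball_d y (e / 2))); last exact: nbhs_ball_d.
  move=> z yz bz; apply: AN; exists y; split => //; apply: eN => /=.
  have := be _ bz; rewrite /= in yz *; have := dD x z y; rewrite (dC z y) => *; lra.
(* At most one member of [D] has index [n]; if there is none, [b n] is empty. *)
pose b n := \bigcup_(c in [set c | D c /\ r c n]) c.
have Fb n : F (~` b n)^°.
  have [[c [Dc rcn]]|nc] := pselect (exists c, D c /\ r c n).
    apply: filterS Dc.2 => x; apply: filterS => y cy [c' [Dc' rc'n]].
    by rewrite (rinj _ _ n Dc'.1 Dc.1 rc'n rcn).
  apply: filterS filterT => x _; apply: filterS filterT => y _ [c Dc _].
  by apply: nc; exists c.
pose O n := \big[setI/setT]_(i < n) (~` b i)^°.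
have [oO FO] : (forall n, open (O n)) /\ forall n, F (O n).
  split => n; rewrite /O.
    by elim/big_ind : _ => [|? ? ? ?|i _]; [exact: openT|exact: openI|exact: open_interior].
  by elim/big_ind : _ => [|? ? ? ?|i _]; [exact: filterT|exact: filterI|exact: Fb].
have /choice[C CP] n : exists C, [/\ clopen C, C !=set0 & C `<=` O n].
  by apply: clopen_below => //; exact: (filter_ex (FO n)).
have Cfin (x : X) : exists m, nbhs x [set y | forall n, C n y -> (n < m)%N].
  have [c Dc cx] := Dcov x; have [n _ rcn] := rB _ Dc.1.
  exists n.+1; apply: filterS (open_nbhs_nbhs (conj (Bo _ Dc.1) cx : open_nbhs x c)).
  move=> y cy m Cmy; rewrite ltnS leqNgt; apply/negP => nm.
  have [_ _ /(_ _ Cmy)] := CP m.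
  rewrite /O (bigD1 (Ordinal nm)) //= => -[/interior_subset + _].
  by apply; exists c.
exists (fun x => [set n | C n x]).
  apply: locally_finite_locally_constant => [n|x]; first by have [] := CP n.
  by have [m xm] := Cfin x; exists `I_m => //; exact: finite_II.
(* Each value is a bounded set of naturals, and every [n] lies in some value because [C n] is
   nonempty; finitely many values could not cover all [n]. *)
move=> fin; apply: infinite_nat.
have : finite_set (\bigcup_(A in range (fun x => [set n | C n x])) A).
  apply: bigcup_finite => // _ [x _ <-].
  have [m /nbhs_singleton xm] := Cfin x.
  by apply: (sub_finite_set _ (finite_II m)) => n /xm.
apply: sub_finite_set => n _; have [_ [x Cnx] _] := CP n.
by exists [set n | C n x] => //; exists x.
Qed.

(** * The case of an uncountable least base *)

Hypothesis hom : weight_homogeneous X.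
Hypothesis unctbl : ~ countable (min_basis X).

(** Uncountability excludes that the maximum in [weight U] is [[set: nat]]. *)
Let min_basis_homogeneous (U : set X) : open U -> U !=set0 ->
  min_basis X #<= min_basis U.
Proof.
move=> oU U0; have := min_basis_card_le_weight X.
have := hom oU U0; rewrite /weight => /card_eqPle[_ XU] /card_le_trans/(_ XU).
rewrite {1}/card_max; case: ifP => _ /card_le_trans/(_ (card_le_image_rel _ _)) //.
Qed.

Lemma uncountable_locally_constant : [set: X] !=set0 ->
  exists (T : Type) (f : X -> T), locally_constant f /\ min_basis X #<= range f.
Proof.
move=> X0.
have k0 k : 0 < k.+1%:R^-1 :> R by rewrite invr_gt0 ltr0n.
have /choice[N NP] (p : set X * nat) := maximal_separated p.1 (k0 p.2).
have Nmin U : open U -> U !=set0 ->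
    min_basis X #<= [set p : nat * X | N (U, p.1) p.2].
  move=> oU U0; apply: card_le_trans (min_basis_homogeneous oU U0) _.
  apply: (@min_basis_card_le_nets _ (fun k => N (U, k))) => k.
  by have [_ _] := NP (U, k).
have Nlc U k : open U ->
    exists2 f : X -> set X, locally_constant f & N (U, k) #<= f @` U.
  move=> oU; have [NU Nsep _] := NP (U, k).
  exact: separated_locally_constant Nsep.
have split_open U : open U -> U !=set0 ->
    exists2 f : X -> set X, locally_constant f & [set: nat] #<= f @` U.
  (* If all nets of [U] were finite, their countable union would bound the least base of [X]. *)
  move=> oU U0; have [k Nk] : exists k, infinite_set (N (U, k)).
    apply: contrapT => nk; apply: unctbl.
    apply: card_le_trans (Nmin U oU U0) _.
    apply: (@sub_countable _ _ _ ([set: nat] `*`` (fun k => N (U, k)))).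
      by apply: subset_card_le => p; split.
    apply: countableXR => // k _; apply: finite_set_countable.
    by apply: contrapT => Nk; apply: nk; exists k.
  have [f lcf Nf] := Nlc U k oU; exists f => //.
  by apply: card_le_trans Nf; exact/infiniteP.
have [f0 lcf0 /infiniteP inff0] := split_open setT openT X0.
have [g lcg rg] := infinite_range_surj lcf0 inff0.
pose V n := g @^-1` [set n].
have oV n : open (V n) by exact: locally_constant_open.
have V0 n : V n !=set0.
  by have : range g n by [rewrite rg]; move=> [x _ gx]; exists x.
have [[n Vn]|nV] :=
    pselect (exists n, forall k, N (V n, k) #<= N ([set: X], n)).
  have [f lcf Nf] := Nlc setT n openT.
  have /choice[h hP] t : exists h : X -> set X, locally_constant h /\
      (range f t -> [set: nat] #<= h @` (f @^-1` [set t])).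
    have [[x _ fx]|nt] := pselect (range f t); last first.
      (* Off the range of [f] any locally constant function will do. *)
      by exists (fun=> set0); split => // x; exact: nearW.
    have [||h lch hf] := @split_open (f @^-1` [set t]); last by exists h.
    - exact: locally_constant_open.
    - by exists x.
  have [f' lcf' ff'] := locally_constant_refine (A := fun=> [set: nat]) lcf
    (fun t => (hP t).1) (fun t => (hP t).2).
  exists _, f'; split => //; apply: card_le_trans ff'.
  (* By homogeneity the nets of the single piece [V n] already bound the base of all of [X]. *)
  apply: card_le_trans (Nmin _ (oV n) (V0 n)) _.
  apply: card_le_trans (card_le_sigma (fun k => card_le_trans (Vn k) Nf)) _.
  by apply: subset_card_le => p.
have /choice[h hP] n : exists h : X -> set X, locally_constant h /\
    N ([set: X], n) #<= h @` V n.
  have [k nk] : exists k, ~ (N (V n, k) #<= N ([set: X], n)).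
    apply: contrapT => nk; apply: nV; exists n => k; apply: contrapT => nVk.
    by apply: nk; exists k.
  have [h lch Nh] := Nlc _ k (oV n); exists h; split => //.
  by apply: card_le_trans Nh; have [] := card_le_total (N (V n, k)) (N (setT, n)).
have [f lcf gf] := locally_constant_refine (A := fun n => N ([set: X], n)) lcg
  (fun n => (hP n).1) (fun n _ => (hP n).2).
exists _, f; split => //; apply: card_le_trans gf.
apply: card_le_trans (Nmin _ openT X0) _.
by apply: subset_card_le => p; rewrite rg.
Qed.

End metric.

(** * From a locally constant function to the partition *)

Theorem theorem2p4 (R : realType) (X : topologicalType) :
  metrizable R X ->
  ~ compact [set: X] ->
  weight_homogeneous X ->
  (exists2 B : set (set X), pi_base B & B `<=` clopen) ->
  exists2 P : set (set X), clopen_partition P & P #= weight X.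
Proof.
move=> [d [d0 dC dD open_dP]] ncpt hom [B piB Bclopen].
have [T [f [lcf [inff wf]]]] : exists (T : Type) (f : X -> T),
    locally_constant f /\ infinite_set (range f) /\ min_basis X #<= range f.
  have [ctbl|unctbl] := pselect (countable (min_basis X)).
    have [f lcf inff] :=
      noncompact_locally_constant d0 dC dD open_dP piB Bclopen ncpt ctbl.
    exists _, f; split => //; split => //.
    by apply: card_le_trans ctbl _; exact/infiniteP.
  have X0 : [set: X] !=set0.
    by apply/set0P/eqP => X0; apply: ncpt; rewrite X0; exact: compact0.
  have [T [f [lcf wf]]] :=
    uncountable_locally_constant d0 dC dD open_dP piB Bclopen hom unctbl X0.
  exists T, f; split => //; split => // finf.
  by apply: unctbl; apply: card_le_trans wf _; exact: finite_set_countable.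
have [P partP fP] := fibers_clopen_partition lcf.
exists P => //; apply/card_eqPle; split.
  exact: card_le_trans (clopen_partition_card_le partP) (min_basis_card_le_weight X).
apply: card_max_le; last exact: card_le_trans wf fP.
by apply: card_le_trans fP; exact/infiniteP.
Qed.
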